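(* Let $H$ be a quasi-complete digraph on $S$ with complete part $T$, and let $(G,S,c)$ be an inner Eulerian network such that the Eulerian condition is fulfilled by each terminal $s$ incident to at most $|T|-2$ edges of $H$. Then $\mathrm{MFP}^*(\mu_H;G,S,c)=\mathrm{IMFP}^*(\mu_H;G,S,c)$, and this common value equals $\sum_{s\in T}\min\{c(\partial X): s\in X\subseteq VG\setminus N_H(s)\}$ if $H$ is sink-type, and $\sum_{s\in T}\min\{c(\partial X): N_H(s)\subseteq X\subseteq VG\setminus\{s\}\}$ if $H$ is source-type.
   Context: A network $(G,S,c)$: finite digraph $G=(VG,EG)$, terminals $S\subseteq VG$, capacity $c:EG\to\mathbb Z_+$. A multiflow is a set $\mathcal P$ of directed paths joining distinct terminals with $\lambda:\mathcal P\to\mathbb R_+$, $\sum_{P\ni e}\lambda(P)\le c(e)$; integral if $\lambda$ integer-valued. For a directed distance $\mu$ on $S$, $\mathrm{MFP}^*(\mu;G,S,c)$ (resp. $\mathrm{IMFP}^*$) is the maximum of $\sum_P\lambda(P)\mu(s_P,t_P)$ ($s_P,t_P$ start and end of $P$) over all (resp. integral) multiflows. A node fulfills the Eulerian condition if its outgoing capacity equals its incoming capacity; inner Eulerian means every non-terminal node does. $\partial X$ is the set of edges of $G$ leaving $X\subseteq VG$. For a simple digraph $H$ with $VH=S$, $\mu_H(s,t)=1$ if $st\in EH$ and $0$ otherwise; $N_H(s)$ is the set of nodes joined to $s$ by an edge of $H$ (in either direction). A quasi-complete digraph is a simple digraph $H$ with a node subset $T$ (complete part) such that (0) every edge is incident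 to $T$, (1) the subgraph induced by $T$ is a complete digraph, and (2) the edges between $T$ and $VH\setminus T$ either all leave $T$ or all enter $T$. $H$ is source-type if these edges enter $T$ and sink-type otherwise. *)

(* Defs.v *)
From mathcomp Require Import all_boot all_order all_algebra.
From mathcomp Require Import finmap.
From mathcomp Require Import reals.

Set Implicit Arguments.
Unset Strict Implicit.
Unset Printing Implicit Defensive.

Import Order.TTheory GRing.Theory Num.Theory.

Local Open Scope nat_scope.

(* Parallel edges and loops are allowed in the underlying digraph. *)
Record network := Network {
  node : finType;
  edge : finType;
  esrc : edge -> node;
  etgt : edge -> node;
  terminals : {set node};
  capacity : edge -> nat
}.

Section Network.
Variable G : network.

Definition leaving (X : {set node G}) : {set edge G} :=
  [set e | (esrc e \in X) && (etgt e \notin X)].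

Definition cut_capacity (X : {set node G}) : nat :=
  \sum_(e in leaving X) capacity e.

Definition eulerian_at (v : node G) : Prop :=
  \sum_(e | esrc e == v) capacity e = \sum_(e | etgt e == v) capacity e.

Definition inner_eulerian : Prop :=
  forall v : node G, v \notin terminals G -> eulerian_at v.

(* A path is its start node with its sequence of edges; the sequence alone
   would not determine the start node of a trivial path. *)
Definition dpath : Type := (node G * seq (edge G))%type.

Definition path_nodes (p : dpath) : seq (node G) :=
  p.1 :: [seq etgt e | e <- p.2].

Definition path_start (p : dpath) : node G := p.1.

Definition path_end (p : dpath) : node G := last p.1 [seq etgt e | e <- p.2].

(* The first condition says that each edge starts at the node that the path
   has reached before it, i.e., that p is a directed walk. *)
Definition is_dpath (p : dpath) : bool :=
  ([seq esrc e | e <- p.2] == belast p.1 [seq etgt e | e <- p.2])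
  && uniq (path_nodes p).

(* Inner nodes of the path may be terminals. *)
Definition is_terminal_path (p : dpath) : bool :=
  [&& is_dpath p, path_start p \in terminals G, path_end p \in terminals G
    & path_start p != path_end p].

End Network.

Section Multiflow.
Variables (R : realType) (G : network).

Local Open Scope ring_scope.

(* Only the values of flow on paths are meaningful. *)
Record multiflow := Multiflow {
  paths : {fset dpath G};
  flow : dpath G -> R;
  paths_terminal : forall p, p \in paths -> is_terminal_path p;
  flow_ge0 : forall p, p \in paths -> 0 <= flow p;
  flow_capacity : forall e : edge G,
    \sum_(p <- paths | e \in p.2) flow p <= (capacity e)%:R
}.

Definition integral_multiflow (f : multiflow) : Prop :=
  forall p, p \in paths f -> flow f p \is a Num.int.

Definition multiflow_value (mu : node G -> node G -> R) (f : multiflow) : R :=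
  \sum_(p <- paths f) flow f p * mu (path_start p) (path_end p).

(* The maximum over all (resp. all integral) multiflows is attained and equals v. *)
Definition is_MFP (mu : node G -> node G -> R) (v : R) : Prop :=
  (exists f : multiflow, multiflow_value mu f = v) /\
  (forall f : multiflow, multiflow_value mu f <= v).

Definition is_IMFP (mu : node G -> node G -> R) (v : R) : Prop :=
  (exists2 f : multiflow, integral_multiflow f & multiflow_value mu f = v) /\
  (forall f : multiflow, integral_multiflow f -> multiflow_value mu f <= v).

End Multiflow.

(* A simple digraph on S is represented by its adjacency relation on the ambient
   type V; pairs of opposite edges are allowed. *)
Section SimpleDigraph.
Variables (V : finType) (S : {set V}) (H : rel V) (T : {set V}).

Definition simple_digraph : Prop :=
  forall s t, H s t -> [/\ s \in S, t \in S & s != t].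

Definition nbh (s : V) : {set V} := [set t | H s t || H t s].

Definition degree (s : V) : nat :=
  #|[set e : V * V | H e.1 e.2 && ((e.1 == s) || (e.2 == s))]|.

Definition crossing_enter : bool :=
  [forall s, forall t, (H s t && ((s \in T) != (t \in T))) ==> (t \in T)].

Definition crossing_leave : bool :=
  [forall s, forall t, (H s t && ((s \in T) != (t \in T))) ==> (s \in T)].

Record quasi_complete : Prop := QuasiComplete {
  qc_simple : simple_digraph;
  qc_subset : T \subset S;
  qc_incident : forall s t, H s t -> (s \in T) || (t \in T);
  qc_complete : {in T &, forall s t, s != t -> H s t};
  qc_crossing : crossing_leave \/ crossing_enter
}.

(* When no edge crosses between T and its complement, H is source-type. *)
Definition source_type : bool := crossing_enter.

Definition sink_type : bool := ~~ source_type.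

Definition mu_of (R : realType) (s t : V) : R := ((H s t)%:R)%R.

End SimpleDigraph.

Section MinCuts.
Variables (G : network) (H : rel (node G)).

(* Since H has no loops, s is not in nbh H s, and the default sets [set s] and
   nbh H s of the two minimisations are feasible. *)
Definition sink_cut (s : node G) : nat :=
  cut_capacity [arg min_(X < [set s] | (s \in X) && (X \subset ~: nbh H s))
                  cut_capacity X].

Definition source_cut (s : node G) : nat :=
  cut_capacity [arg min_(X < nbh H s | (nbh H s \subset X) && (X \subset ~: [set s]))
                  cut_capacity X].

End MinCuts.

(* Main.v *)
(* Reversing all edges exchanges the two types, so let the edges of H between T and
   its complement leave T. Writing N(s) for the neighbours of s, the degree hypothesis
   makes every node outside N(s) and N(t), for two distinct s, t in T, Eulerian. It remains to find edge-disjoint walks, lam(s) of them from s to N(s)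
   for each s in T, where lam(s) is the least capacity of a cut separating s from
   N(s); such cuts also give the upper bound.

   This goes by induction on the number of edges, only asking that these nodes have
   at least as many outgoing as incoming edges. Take an edge s -> v with lam(s) > 0.
   If v is in N(s), it is one of the walks, and it lies in no cut of another terminal.
   If it leaves no tight set of s, delete it. Otherwise uncrossing of tight sets finds
   an edge v -> w such that replacing both edges by s -> w keeps all cuts at least
   lam. *)

Require Import Defs.
From mathcomp Require Import all_boot all_order all_algebra.
From mathcomp Require Import finmap.
From mathcomp Require Import reals.
From mathcomp Require Import zify.

Set Implicit Arguments.
Unset Strict Implicit.
Unset Printing Implicit Defensive.

Import Order.TTheory GRing.Theory Num.Theory.

(** * Submodularity and related inequalities for directed cuts *)

Section CutInequalities.
Local Open Scope nat_scope.
Variables (V : finType) (A : eqType) (src tgt : A -> V).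
Implicit Types (E : seq A) (X Y Z : {set V}) (v : V).

(** Edges are entries of a list, so parallel edges count separately; [A] is left open because the
    entries will be walks, seen as edges from start to end. *)
Definition out_cut E X := count (fun p => (src p \in X) && (tgt p \notin X)) E.

Lemma count_sum_bool (P : pred A) E : count P E = \sum_(p <- E) (P p : nat).
Proof. by rewrite -sum1_count big_mkcond; apply: eq_bigr => p _; case: (P p). Qed.

Lemma leq_sum_mem (f g : A -> nat) E :
  {in E, forall p, f p <= g p} -> \sum_(p <- E) f p <= \sum_(p <- E) g p.
Proof. by move=> fg; rewrite big_seq [leqRHS]big_seq; apply: leq_sum. Qed.

Lemma count_fiber (f : A -> V) E X :
  \sum_(v in X) count (fun p => f p == v) E = count (fun p => f p \in X) E.
Proof.
under eq_bigr do rewrite count_sum_bool.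
rewrite exchange_big count_sum_bool; apply: eq_bigr => p _ /=.
case: (boolP (f p \in X)) => [fX|fX].
  rewrite (bigD1 (f p)) //= eqxx big1 // => v /andP[_ /negPf].
  by rewrite eq_sym => ->.
rewrite big1 // => v vX; case: eqP => // fv; by rewrite fv vX in fX.
Qed.

Lemma out_cut_submod E X Y :
  out_cut E (X :|: Y) + out_cut E (X :&: Y) <= out_cut E X + out_cut E Y.
Proof.
rewrite /out_cut !count_sum_bool -!big_split; apply: leq_sum => p _.
rewrite !inE.
by case: (src p \in X); case: (src p \in Y);
   case: (tgt p \in X); case: (tgt p \in Y).
Qed.

(* The surplus of outgoing edges at the nodes of [X :&: Y] pays for turning the
   posi-modularity of undirected cuts into one for directed cuts. *)
Lemma out_cut_posimod E X Y :
    (forall v, v \in X :&: Y ->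
       count (fun p => tgt p == v) E <= count (fun p => src p == v) E) ->
  out_cut E (X :\: Y) + out_cut E (Y :\: X)
    + count (fun p => (src p \notin X :|: Y) && (tgt p \in X :&: Y)) E
  <= out_cut E X + out_cut E Y.
Proof.
move=> balance.
have : count (fun p => tgt p \in X :&: Y) E <= count (fun p => src p \in X :&: Y) E.
  by rewrite -!count_fiber; apply: leq_sum.
suff : out_cut E (X :\: Y) + out_cut E (Y :\: X)
    + count (fun p => (src p \notin X :|: Y) && (tgt p \in X :&: Y)) E
    + count (fun p => src p \in X :&: Y) E
  <= out_cut E X + out_cut E Y + count (fun p => tgt p \in X :&: Y) E by lia.
rewrite /out_cut !count_sum_bool -!big_split; apply: leq_sum => p _.
rewrite !inE.
by case: (src p \in X); case: (src p \in Y);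
   case: (tgt p \in X); case: (tgt p \in Y).
Qed.

(** The edges leaving [v] end in [Z], so adding [v] to [Z] creates no new leaving edge, while the
    edges from [Z] to [v] cease to leave. *)
Lemma out_cut_add E Z v :
    {in E, forall p, src p = v -> tgt p \in Z} -> v \notin Z ->
  out_cut E (v |: Z) + count (fun p => (src p \in Z) && (tgt p == v)) E
  <= out_cut E Z.
Proof.
move=> outZ vZ.
rewrite /out_cut !count_sum_bool -!big_split; apply: leq_sum_mem => p pE /=.
rewrite !inE; have := outZ p pE.
case: eqP => [->|_ _] /=; first by move=> /(_ erefl) ->; rewrite (negPf vZ) orbT.
by case: eqP => [->|_] /=; rewrite ?(negPf vZ); case: (src p \in Z);
   case: (tgt p \in Z).
Qed.

(** All edges leaving [v] leave [Y], so taking [v] out saves them; the edges gained enter [v] from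
    inside [Y], hence not from [u]. *)
Lemma out_cut_remove E Y v u :
    {in E, forall p, src p = v -> tgt p \notin Y} -> v \in Y -> u \notin Y ->
  out_cut E (Y :\ v) + count (fun p => src p == v) E
    + count (fun p => (src p == u) && (tgt p == v)) E
  <= out_cut E Y + count (fun p => tgt p == v) E.
Proof.
move=> outY vY uY.
rewrite /out_cut !count_sum_bool -!big_split; apply: leq_sum_mem => p pE /=.
rewrite !inE; have := outY p pE.
case: (src p =P v) => [->|_ _] /=.
  move=> /(_ erefl) ->; rewrite vY /=; 
  case: (v =P u) => [vu|_]; last by case: (tgt p == v).
  by rewrite vu (negPf uY) in vY.
case: (tgt p =P v) => [->|_] /=; rewrite ?vY /= ?andbF ?andbT ?addn0 //.
by case: (src p =P u) => [->|_]; rewrite ?(negPf uY) ?andbF //=; case: (_ \in Y).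
Qed.

End CutInequalities.

(** * Walks, concatenation and loop erasure *)

Section Walks.
Local Open Scope nat_scope.
Variable G : network.
Implicit Types (p q : dpath G) (E L : seq (dpath G)).

Definition is_walk p := [seq esrc e | e <- p.2] == belast p.1 [seq etgt e | e <- p.2].

Definition usage L (e : edge G) := \sum_(p <- L) count_mem e p.2.

(** The edge that replaces [p] and [q] when they are split off; it remembers the edges of [G] it
    stands for. *)
Definition join p q : dpath G := (p.1, p.2 ++ q.2).

Lemma path_end_join p q : path_end p = path_start q -> path_end (join p q) = path_end q.
Proof. by rewrite /path_end /join /= map_cat last_cat => ->. Qed.

Lemma is_walk_join p q :
  is_walk p -> is_walk q -> path_end p = path_start q -> is_walk (join p q).
Proof.
move=> /eqP wp /eqP wq pq; apply/eqP.
by rewrite /join /= !map_cat belast_cat wp wq -/(path_end p) pq.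
Qed.

Lemma is_walk_cons x e es :
  is_walk (x, e :: es) = (esrc e == x) && is_walk (etgt e, es).
Proof. by rewrite /is_walk /= eqseq_cons. Qed.

Lemma walk_suffix x y (es : seq (edge G)) :
    is_dpath (y, es) -> x \in path_nodes (y, es) ->
  exists es', [/\ is_dpath (x, es'), path_end (x, es') = path_end (y, es)
    & subseq es' es].
Proof.
elim: es y => [|e es IH] y.
  by rewrite /path_nodes /= inE => d /eqP ->; exists [::].
have [->|xy] := eqVneq x y; first by move=> d _; exists (e :: es).
rewrite /is_dpath -/(is_walk _) is_walk_cons /path_nodes /=.
case/andP=> /andP[_ w] /andP[_ u]; rewrite inE (negPf xy) /= => xin.
have [es' [d' l' s']] : exists es', [/\ is_dpath (x, es'),
    path_end (x, es') = path_end (etgt e, es) & subseq es' es].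
  by apply: IH => //; rewrite /is_dpath -/(is_walk _) w.
by exists es'; split => //; apply: subseq_trans s' (subseq_cons _ _).
Qed.

(** The tail is shortened first; if it meets [x] again, its suffix from [x] replaces the whole walk.
    A subsequence uses no edge more often. *)
Lemma walk_shorten x (es : seq (edge G)) : is_walk (x, es) ->
  exists es', [/\ is_dpath (x, es'), path_end (x, es') = path_end (x, es)
    & subseq es' es].
Proof.
elim: es x => [|e es IH] x; first by exists [::].
rewrite is_walk_cons => /andP[/eqP ex w].
have [es1 [d1 l1 s1]] := IH _ w.
have [xin|xnin] := boolP (x \in path_nodes (etgt e, es1)).
  have [es2 [d2 l2 s2]] := walk_suffix d1 xin.
  exists es2; split => //; first by rewrite l2 l1.
  by apply: subseq_trans (subseq_cons _ _); apply: subseq_trans s1.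
exists (e :: es1); split; last by rewrite /= eqxx.
  rewrite /is_dpath -/(is_walk _) is_walk_cons ex eqxx /=.
  by case/andP: d1 => w1 u1; rewrite /is_walk w1 xnin.
by rewrite /path_end /= in l1 *.
Qed.

Lemma shorten_walks (L : seq (dpath G)) : all (is_walk) L ->
  exists L', [/\ all (@is_dpath G) L', forall e, usage L' e <= usage L e
    & [seq (path_start p, path_end p) | p <- L']
      = [seq (path_start p, path_end p) | p <- L]].
Proof.
elim: L => [|[x es] L IH] /=; first by exists [::].
move=> /andP[w /IH[L' [dL' uL' eL']]].
have [es' [d' e' s']] := walk_shorten w.
exists ((x, es') :: L'); split; rewrite /= ?d' ?eL' ?e' //.
by move=> e; rewrite /usage !big_cons leq_add ?uL' // leq_count_subseq.
Qed.

End Walks.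

(** * Linear arithmetic closing the uncrossing arguments *)

Section Arithmetic.
Local Open Scope nat_scope.

Lemma leq_add_cancel x y a b : x + y <= a + b -> b <= y -> x <= a.
Proof. by lia. Qed.

Lemma add_pos_leqF x n a : x + n <= a -> a <= x -> 0 < n -> False.
Proof. by lia. Qed.

Lemma add2_pos_leqF x y n a b : x + y + n <= a + b -> a <= x -> b <= y -> 0 < n -> False.
Proof. by lia. Qed.

(** For the end of [split_exists]: [x], [y], [z] are the cuts of [Z :\: Y], [Y :\: Z] and the latter
    without [v]; [o] and [i] are the out- and indegree of [v], [n] counts the edges from [s] to [v],
    and [a], [b] are [lam s], [lam t]. *)
Lemma add3_pos_leqF x y z n m a b i o :
  x + y + m <= a + b -> z + o + n <= y + i -> a <= x -> b <= z -> i <= o -> 0 < n ->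
  False.
Proof. by lia. Qed.

End Arithmetic.

(** * Splitting off edges to obtain disjoint walks from [T] *)

Section Locking.
Local Open Scope nat_scope.
Variables (G : network) (T : {set node G}) (N : node G -> {set node G}).
Hypothesis N_self : forall s, s \in T -> s \notin N s.
Hypothesis N_other : {in T &, forall s t, s != t -> s \in N t}.

Local Notation start := (@path_start G).
Local Notation stop := (@path_end G).
Local Notation cut := (out_cut start stop).
Implicit Types (X Y Z : {set node G}) (E L : seq (dpath G)) (lam : node G -> nat).

(* [N s] is the set of nodes at which the paths starting at [s] may end. *)
Definition feasible s X := (s \in X) && [disjoint X & N s].

(** An inequality, because deleting an edge that starts in [T] can lower the indegree of such a node
    but not its outdegree. *)
Definition balanced E := forall v s t, s \in T -> t \in T -> s != t ->
  v \notin N s -> v \notin N t ->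
  count (fun p => stop p == v) E <= count (fun p => start p == v) E.

Definition covers lam E := forall s X, s \in T -> feasible s X -> lam s <= cut E X.

Lemma feasible_in s X v : feasible s X -> v \in X -> v \notin N s.
Proof. by case/andP=> _ d vX; rewrite (disjointFr d vX). Qed.

Lemma feasible_sub s X Y : feasible s X -> Y \subset X -> s \in Y -> feasible s Y.
Proof. by case/andP=> _ d YX sY; rewrite /feasible sY (disjointWl YX). Qed.

(** Every other node of [T] lies in [N t]. Hence an edge starting at [s] leaves feasible sets of [s]
    only, and deleting it does not affect the other terminals. *)
Lemma feasible_eq s t X : s \in T -> t \in T -> feasible t X -> s \in X -> t = s.
Proof.
move=> sT tT fX sX; apply/eqP; apply: contraT; rewrite eq_sym => st.
by have := feasible_in fX sX; rewrite N_other.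
Qed.

Lemma feasibleU s X Y : feasible s X -> feasible s Y -> feasible s (X :|: Y).
Proof.
case/andP=> sX dX /andP[_ dY]; rewrite /feasible inE sX /=.
by move: dX dY; rewrite !disjoints_subset subUset => -> ->.
Qed.

Lemma feasible_add s X v : feasible s X -> v \notin N s -> feasible s (v |: X).
Proof.
case/andP=> sX dX vN; rewrite /feasible inE sX orbT /=.
by move: dX; rewrite !disjoints_subset subUset sub1set inE vN.
Qed.

(* A node that is balanced by hypothesis is never in [T], so [E] stays balanced
   when edges leaving a node of [T] are removed. *)
Lemma balanced_rem E p : start p \in T -> balanced (p :: E) -> balanced E.
Proof.
move=> sT bal v s t sT' tT st vs vt.
have := bal v s t sT' tT st vs vt => /=.
have -> : (start p == v) = false.
  apply/negP => /eqP pv; rewrite pv in sT.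
  have vs' : v = s by apply/eqP; apply: contraNT vs; apply: N_other.
  have vt' : v = t by apply/eqP; apply: contraNT vt; apply: N_other.
  by rewrite -vs' -vt' eqxx in st.
by lia.
Qed.

Lemma cut_cons p E X : cut (p :: E) X = ((start p \in X) && (stop p \notin X)) + cut E X.
Proof. by []. Qed.

Lemma cut_perm E E' X : perm_eq E E' -> cut E X = cut E' X.
Proof. by move/permP; apply. Qed.

(* [Z] is a largest tight set of [s] avoiding [v]. If no edge leaving [v] can be
   split off with [p], then by uncrossing every edge from [v] to the outside of [Z]
   is blocked by tight sets of one single terminal [t]; with [Y] the least tight set
   of [t] containing [v], all edges leaving [v] also leave [Y :\: Z], which is tight,
   and removing [v] from it contradicts the balance at [v]. *)
Lemma split_exists lam E p (Z0 : {set node G}) :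
    balanced E -> covers lam E -> p \in E -> start p \in T ->
    stop p \notin N (start p) ->
    feasible (start p) Z0 -> stop p \notin Z0 -> cut E Z0 = lam (start p) ->
  exists2 q, (q \in E) && (start q == stop p) &
    forall t X, t \in T -> feasible t X -> cut E X = lam t ->
      ~~ [|| [&& start p \in X, stop p \notin X & stop q \in X]
           | [&& start p \notin X, stop p \in X & stop q \notin X]].
Proof.
set s := start p; set v := stop p => bal cov pE sT vN fZ0 vZ0 tZ0.
pose tightS X := [&& feasible s X, v \notin X & cut E X == lam s].
have [Z /maxsetP[/and3P[fZ vZ /eqP tZ] Zmax]] : {Z | maxset tightS Z}.
  by apply: ex_maxset; exists Z0; rewrite /tightS fZ0 vZ0 tZ0 eqxx.
pose tightT X := [exists t, [&& t \in T, t != s, feasible t X & cut E X == lam t]]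
                  && (v \in X).
(* The two alternatives are exactly the positions of [s], [v] and [stop q] for which replacing both
   edges by their join lowers the cut of [X]. *)
pose bad q t X := [&& t \in T, feasible t X, cut E X == lam t
   & [|| [&& s \in X, v \notin X & stop q \in X]
           | [&& s \notin X, v \in X & stop q \notin X]]].
have [/hasP[q qE /andP[qv nb]]|/hasPn allbad] :=
  boolP (has (fun q => (start q == v) && ~~ [exists t, [exists X, bad q t X]]) E).
  exists q; rewrite ?qE // => t X tT fX tX; apply: contraNN nb => b.
  by apply/existsP; exists t; apply/existsP; exists X; rewrite /bad tT fX tX eqxx.
(* A bad set containing [s] belongs to [s]; its union with [Z] would be tight, avoid [v] and contain
   [stop q], against the maximality of [Z]. Any other bad set misses [s], so its terminal is not
   [s]. *)
have blocked q : q \in E -> start q = v -> stop q \notin Z ->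
    exists t Y, [/\ t \in T, t != s, feasible t Y, cut E Y = lam t
      & v \in Y /\ stop q \notin Y].
  move=> qE qv qZ; have := allbad q qE; rewrite qv eqxx /= negbK.
  case/existsP=> t /existsP[X /and4P[tT fX /eqP tX]].
  case/orP=> [/and3P[sX vX wX]|/and3P[sX vX wX]]; last first.
    exists t, X; split => //; apply: contraNneq sX => <-.
    by case/andP: fX.
  have ts := feasible_eq sT tT fX sX; subst t.
  have fU := feasibleU fX fZ.
  have fI : feasible s (X :&: Z).
    by apply: (feasible_sub fZ); rewrite ?subsetIr // inE sX; case/andP: fZ.
  have tU : tightS (X :|: Z).
    rewrite /tightS fU inE negb_or vX vZ /= eqn_leq (cov _ _ sT fU) andbT.
    have := out_cut_submod start stop E X Z; rewrite tX tZ => /leq_add_cancel.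
    by apply; apply: cov.
  have := Zmax _ tU (subsetUr _ _) => eZ.
  by rewrite -eZ inE wX in qZ.
have sv_pos (P : pred (dpath G)) : P p -> 0 < count P E.
  by move=> Pp; rewrite -has_count; apply/hasP; exists p.
have sZ : s \in Z by case/andP: fZ.
(* Some edge from [v] leaves [Z]: otherwise [v |: Z] would be feasible, and [p], leading from [Z] to
   [v], would put its cut below [lam s]. *)
have [/hasP[q0 q0E /andP[/eqP q0v q0Z]]|/hasPn allZ] :=
  boolP (has (fun q => (start q == v) && (stop q \notin Z)) E); last first.
  have : cut E (v |: Z) + count (fun p => (start p \in Z) && (stop p == v)) E
           <= cut E Z.
    apply: out_cut_add => // q qE qv.
    by have := allZ q qE; rewrite qv eqxx negbK.
  rewrite tZ => /add_pos_leqF []; first exact: cov (feasible_add fZ vN).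
  by apply: sv_pos; rewrite -/s -/v sZ eqxx.
have [t0 [Y0 [t0T t0s fY0 tY0 [vY0 _]]]] := blocked q0 q0E q0v q0Z.
have [Y /minsetP[/andP[/existsP[t /and4P[tT ts fY /eqP tY]] vY] Ymin]] :
    {Y | minset tightT Y}.
  apply: ex_minset; exists Y0; rewrite /tightT vY0 andbT.
  by apply/existsP; exists t0; rewrite t0T t0s fY0 tY0 eqxx.
have notin_other r X : r \in T -> r != s -> feasible r X -> s \notin X.
  move=> rT rs fX; apply: contraNN rs => sX.
  by apply/eqP; apply: feasible_eq fX sX.
have sY := notin_other _ _ tT ts fY.
have outY q : q \in E -> start q = v -> stop q \notin Y :\: Z.
  move=> qE qv; rewrite inE negb_and negbK.
  have [//|qZ] := boolP (stop q \in Z); rewrite /=.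
  have [t' [Y' [t'T t's fY' tY' [vY' wY']]]] := blocked q qE qv qZ.
  (* For distinct terminals, posi-modularity makes both differences tight and leaves no room for
     [p], which enters [Y :&: Y'] from outside the union. *)
  have tt' : t' = t.
    apply/eqP; apply: contraT; rewrite eq_sym => tt'.
    have tY'n : t \notin Y'.
      by apply: contraNN tt' => tin; rewrite eq_sym; apply/eqP;
        exact: feasible_eq fY' tin.
    have t'Yn : t' \notin Y.
      by apply: contraNN tt' => t'Y; apply/eqP; apply: feasible_eq fY t'Y.
    have f1 : feasible t (Y :\: Y').
      by apply: (feasible_sub fY); rewrite ?subsetDl // inE tY'n; case/andP: fY.
    have f2 : feasible t' (Y' :\: Y).
      by apply: (feasible_sub fY'); rewrite ?subsetDl // inE t'Yn; case/andP: fY'.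
    have : cut E (Y :\: Y') + cut E (Y' :\: Y)
        + count (fun p => (start p \notin Y :|: Y') && (stop p \in Y :&: Y')) E
        <= cut E Y + cut E Y'.
      apply: out_cut_posimod => x; rewrite inE => /andP[xY xY'].
      by apply: (bal x t t'); rewrite ?(feasible_in fY) ?(feasible_in fY').
    rewrite tY tY' => /add2_pos_leqF []; [exact: cov f1|exact: cov f2|].
    apply: sv_pos; rewrite -/s -/v !inE vY vY' negb_or sY /= andbT.
    exact: notin_other fY'.
  subst t'.
  have tinY : t \in Y by case/andP: fY.
  (* By submodularity [Y :&: Y'] is tight, so minimality puts [Y] inside [Y'], which misses
     [stop q]. *)
  have fI : feasible t (Y :&: Y').
    by apply: (feasible_sub fY); rewrite ?subsetIl // inE tinY; case/andP: fY'.
  have tI : tightT (Y :&: Y').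
    rewrite /tightT inE vY vY' /= andbT; apply/existsP; exists t.
    rewrite tT ts fI /= eqn_leq (cov _ _ tT fI) andbT.
    have := out_cut_submod start stop E Y Y'; rewrite tY tY' addnC.
    by move=> /leq_add_cancel; apply; apply: cov (feasibleU fY fY').
  by have := Ymin _ tI (subsetIl _ _) => eY; rewrite -eY inE (negPf wY') andbF.
have vN' := feasible_in fY vY.
have tZn : t \notin Z.
  by apply: contraNN ts => tZ'; rewrite eq_sym; apply/eqP; apply: feasible_eq fZ tZ'.
have tv : t != v.
  by apply: contraTneq tT => tv; apply: contraNN vN => vT; rewrite -tv N_other // tv.
have f1 : feasible s (Z :\: Y).
  by apply: (feasible_sub fZ); rewrite ?subsetDl // inE sY sZ.
have f2 : feasible t ((Y :\: Z) :\ v).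
  apply: (feasible_sub fY); last by rewrite !inE tv tZn; case/andP: fY.
  by apply: subset_trans (subsetDl _ _) (subsetDl _ _).
have : cut E (Z :\: Y) + cut E (Y :\: Z)
    + count (fun p => (start p \notin Z :|: Y) && (stop p \in Z :&: Y)) E
    <= cut E Z + cut E Y.
  apply: out_cut_posimod => x; rewrite inE => /andP[xZ xY].
  by apply: (bal x s t); rewrite ?(feasible_in fZ) ?(feasible_in fY) // eq_sym.
have vYZ : v \in Y :\: Z by rewrite inE vZ vY.
have sYZ : s \notin Y :\: Z by rewrite inE sZ.
rewrite tZ tY => /add3_pos_leqF /(_ (out_cut_remove outY vYZ sYZ)) [].
- exact: cov f1.
- exact: cov f2.
- by apply: (bal v s t) => //; rewrite eq_sym.
- by apply: sv_pos; rewrite !eqxx.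
Qed.

Lemma balanced_perm E E' : perm_eq E E' -> balanced E -> balanced E'.
Proof. by move=> /permP eE bal v s t; rewrite -!eE; apply: bal. Qed.

(** Degrees change only where [p] and [q] meet, by one incoming and one outgoing edge. *)
Lemma balanced_join E p q : stop p = start q ->
  balanced [:: p, q & E] -> balanced (join p q :: E).
Proof.
move=> pq bal v s t sT tT st vs vt; have := bal v s t sT tT st vs vt => /=.
by rewrite (path_end_join pq) pq /join /path_start /= (addnCA (p.1 == v)) leq_add2l.
Qed.

(** The entries of [E] act as edges although each is a walk of [G]; the bound on [usage] expresses
    disjointness once edges have been merged. *)
Lemma locking E lam :
    balanced E -> covers lam E -> all (@is_walk G) E ->
  exists L, [/\ all (@is_walk G) L, forall e, usage L e <= usage E e,
    {in L, forall p, (start p \in T) && (stop p \in N (start p))}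
    & size L = \sum_(s in T) lam s].
Proof.
have [n] := ubnP (size E); elim: n => // n IH in E lam *.
rewrite ltnS => szE bal cov wE.
have [/exists_inP[s sT lam_s]|/exists_inPn lam0] := boolP [exists s in T, 0 < lam s];
    last first.
  exists [::]; split => //; first by move=> e; rewrite /usage big_nil.
  by rewrite big1 // => t tT; apply/eqP; rewrite -leqn0 leqNgt lam0.
have fs : feasible s [set s] by rewrite /feasible set11 disjoints1 N_self.
have : 0 < cut E [set s] by apply: leq_trans lam_s (cov _ _ sT fs).
rewrite -has_count => /hasP[p pE /andP[]]; rewrite inE => /eqP ps _.
have eE := perm_to_rem pE; set E1 := rem p E in eE.
have eU e : usage E e = count_mem e p.2 + usage E1 e.
  by rewrite /usage (perm_big _ eE) big_cons.
have eC X : cut E X = ((s \in X) && (stop p \notin X)) + cut E1 X.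
  by rewrite (cut_perm _ eE) cut_cons ps.
have /andP[wp wE1] : all (@is_walk G) (p :: E1) by rewrite -(perm_all _ eE).
have szE1 : size E1 < n by move: szE; rewrite (perm_size eE).
have bal1 : balanced E1.
  by apply: (@balanced_rem _ p); rewrite ?ps //; apply: balanced_perm bal.
have [vN|vN] := boolP (stop p \in N s).
  (* The walk [p] meets one unit of the demand of [s], and no feasible set of another terminal loses
     it. *)
  have [|L [wL uL tL szL]] := IH E1 (fun t => lam t - (t == s)) szE1 bal1 _ wE1.
    move=> t X tT fX; have := cov t X tT fX; rewrite eC.
    have [->|ts] := eqVneq t s; first by rewrite leq_subLR => /leq_trans; apply;
      rewrite leq_add2r leq_b1.
    case: (boolP (s \in X)) => [sX|_]; last by rewrite subn0.
    by rewrite (feasible_eq sT tT fX sX) eqxx in ts.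
  exists (p :: L); split; first by rewrite /= wp.
  - by move=> e; rewrite eU /usage big_cons leq_add2l uL.
  - by move=> q; rewrite inE => /predU1P[->|/tL //]; rewrite ps sT.
  rewrite /= szL (bigD1 s sT) [RHS](bigD1 s sT) /= eqxx -addSn subn1 prednK //.
  by congr (_ + _); apply: eq_bigr => t /andP[_ /negPf ->]; rewrite subn0.
have [/existsP[Z /and3P[fZ vZ /eqP tZ]]|/existsPn loose] :=
    boolP [exists X, [&& feasible s X, stop p \notin X & cut E X == lam s]]; last first.
  have [|L [wL uL tL szL]] := IH E1 lam szE1 bal1 _ wE1.
    move=> t X tT fX; have := cov t X tT fX.
    case: (boolP ((s \in X) && (stop p \notin X))) => [/andP[sX vX]|sv]; last first.
      by rewrite eC (negPf sv).
    have ts := feasible_eq sT tT fX sX; subst t.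
    have := loose X; rewrite fX vX /= eq_sym => ne le.
    have : lam s < cut E X by rewrite ltn_neqAle ne le.
    by rewrite eC sX vX.
  by exists L; split => // e; apply: leq_trans (uL e) _; rewrite eU leq_addl.
rewrite -ps in sT vN fZ tZ.
have [q /andP[qE /eqP qv] qok] := split_exists bal cov pE sT vN fZ vZ tZ.
rewrite ps in sT vN fZ tZ qok.
(* [q] is not [p]: it starts at [stop p], outside [Z], whereas [p] starts inside. *)
have qE1 : q \in E1.
  move: qE; rewrite (perm_mem eE) inE => /predU1P[qp|//].
  by move: vZ; rewrite -qv qp ps; case/andP: fZ => ->.
have eE1 := perm_to_rem qE1; set E2 := rem q E1 in eE1.
have /andP[wq wE2] : all (@is_walk G) (q :: E2) by rewrite -(perm_all _ eE1).
have eE2 : perm_eq E [:: p, q & E2] by apply: perm_trans eE _; rewrite perm_cons.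
have [|||L [wL uL tL szL]] :=
  IH (join p q :: E2) lam _ (balanced_join (esym qv) (balanced_perm eE2 bal)).
- by rewrite (leq_ltn_trans _ szE1) // (perm_size eE1).
- move=> t X tT fX; have := cov t X tT fX; have := qok t X tT fX.
  have js : start (join p q) = s := ps.
  rewrite eC (cut_perm _ eE1) !cut_cons js qv.
  rewrite (path_end_join (esym qv)) => tight le.
  (* The replacement lowers a cut by at most one, which a set that is not tight can afford; for
     tight sets the choice of [q] excludes any loss. *)
  have [eq|ne] := eqVneq (((s \in X) && (stop p \notin X))
      + (((stop p \in X) && (stop q \notin X)) + cut E2 X)) (lam t).
    have := tight eq; move: le; clear.
    by case: (s \in X); case: (stop p \in X); case: (stop q \in X).
  have {ne le tight}: lam t < ((s \in X) && (stop p \notin X))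
      + (((stop p \in X) && (stop q \notin X)) + cut E2 X).
    by rewrite ltn_neqAle eq_sym ne le.
  move=> lt; rewrite -ltnS; apply: leq_trans lt _.
  by case: (s \in X); case: (stop p \in X); case: (stop q \in X).
- by rewrite /= is_walk_join // qv.
exists L; split => // e; apply: leq_trans (uL e) _.
rewrite eU /usage (perm_big _ eE1) !big_cons /= count_cat addnA.
exact: leqnn.
Qed.

Lemma sum_edge_walks (f : dpath G -> nat) :
  \sum_(p <- flatten [seq nseq (capacity e) (esrc e, [:: e]) | e <- enum (edge G)]) f p
  = \sum_(e : edge G) capacity e * f (esrc e, [:: e]).
Proof.
rewrite big_flatten big_map big_enum; apply: eq_bigr => e _ /=.
by rewrite big_nseq iter_addn_0 mulnC.
Qed.

Lemma terminal_walks lam :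
    (forall v s t, s \in T -> t \in T -> s != t -> v \notin N s -> v \notin N t ->
       eulerian_at v) ->
    (forall s X, s \in T -> feasible s X -> lam s <= cut_capacity X) ->
  exists L, [/\ all (@is_walk G) L, forall e, usage L e <= capacity e,
    {in L, forall p, (start p \in T) && (stop p \in N (start p))}
    & size L = \sum_(s in T) lam s].
Proof.
move=> eul cov.
(* Each edge contributes as many one-edge walks as its capacity. *)
pose E := flatten [seq nseq (capacity e) (esrc e, [:: e]) | e <- enum (edge G)].
have cntE P : count P E = \sum_(e | P (esrc e, [:: e])) capacity e.
  rewrite count_sum_bool sum_edge_walks [RHS]big_mkcond; apply: eq_bigr => e _ /=.
  by case: (P _); rewrite ?muln1 ?muln0.
have [|||L [wL uL tL szL]] := @locking E lam.
- by move=> v s t sT tT st vs vt; rewrite !cntE -(eul v s t).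
- move=> s X sT fX; rewrite /out_cut cntE.
  apply: leq_trans (cov _ _ sT fX) _; rewrite /cut_capacity.
  by rewrite (eq_bigl _ _ (in_set _)).
- apply/allP => p /flattenP[es /mapP[e _ ->]] /nseqP[-> _].
  by rewrite /is_walk eqxx.
exists L; split => // e; apply: leq_trans (uL e) _.
rewrite /usage sum_edge_walks (bigD1 e) //= eqxx muln1 big1 ?addn0 // => e' /negPf.
by rewrite addn0 => ->; rewrite muln0.
Qed.

End Locking.

(** * Reversing all edges of the network *)

Section Reversal.
Local Open Scope nat_scope.
Variable G : network.

Definition rev_network : network :=
  {| node := node G; edge := edge G; esrc := @etgt G; etgt := @esrc G;
     terminals := terminals G; capacity := @capacity G |}.

Definition rev_path (p : dpath rev_network) : dpath G := (path_end p, rev p.2).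

Lemma rev_pathP (p : dpath rev_network) : is_walk p ->
  is_walk (rev_path p) /\ path_end (rev_path p) = path_start p.
Proof.
move=> /eqP wp; rewrite /is_walk /path_end /=.
(* Both sides are the reversed node sequence of [p]; comparing last entries gives the end, comparing
   the rest gives the walk condition. *)
have : rcons (belast (path_end p) (map (@etgt G) (rev p.2)))
    (last (path_end p) (map (@etgt G) (rev p.2)))
  = rcons (map (@esrc G) (rev p.2)) p.1.
  rewrite -lastI !map_rev -rev_cons -rev_rcons.
  congr rev; rewrite [in RHS]lastI.
  by congr rcons; exact: wp.
by case/rcons_inj => <- ->.
Qed.

Lemma usage_rev_path (L : seq (dpath rev_network)) e :
  usage (map rev_path L) e = usage L e.
Proof. by rewrite /usage big_map; apply: eq_bigr => p _; rewrite count_rev. Qed.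

Lemma cut_capacity_rev (X : {set node G}) :
  @cut_capacity rev_network X = cut_capacity (~: X).
Proof. by apply: eq_bigl => e; rewrite !inE negbK andbC. Qed.

Lemma eulerian_at_rev (v : node G) : eulerian_at v -> @eulerian_at rev_network v.
Proof. by move=> ev; rewrite /eulerian_at -ev. Qed.

End Reversal.

(** * Cut bounds for multiflows, and integral multiflows from paths *)

Section Multiflows.
Variables (R : realType) (G : network).
Local Open Scope ring_scope.

Lemma walk_leaves x (es : seq (edge G)) (X : {set node G}) :
    is_walk (x, es) -> x \in X -> path_end (x, es) \notin X ->
  exists2 e, e \in es & e \in leaving X.
Proof.
elim: es x => [|e es IH] x; first by move=> _; rewrite /path_end /= => ->.
rewrite is_walk_cons => /andP[/eqP ex w] xX endX.
have [eX|eX] := boolP (etgt e \in X); last first.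
  by exists e; rewrite ?mem_head // inE ex xX.
by have [e' e'es e'X] := IH _ w eX endX; exists e' => //; rewrite inE e'es orbT.
Qed.

(** Each such path uses an edge leaving [X], so summing the capacity constraints over these edges
    counts its flow at least once. *)
Lemma flow_cut_le (f : multiflow R G) (X : {set node G}) :
  \sum_(p <- paths f | (path_start p \in X) && (path_end p \notin X)) flow f p
    <= (cut_capacity X)%:R.
Proof.
rewrite /cut_capacity natr_sum.
apply: (@le_trans _ _ (\sum_(e in leaving X) \sum_(p <- paths f | e \in p.2) flow f p));
  last by apply: ler_sum => e _; apply: flow_capacity.
under [leRHS]eq_bigr do rewrite big_mkcond.
rewrite exchange_big /= big_mkcond big_seq [leRHS]big_seq.
apply: ler_sum => p pf; have f0 := flow_ge0 pf.
have nneg e : 0 <= (if e \in p.2 then flow f p else 0) by case: ifP.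
case: ifP => [/andP[sX tX]|_]; last exact: sumr_ge0.
have /and4P[/andP[wp _] _ _ _] := paths_terminal pf.
case: p wp sX tX f0 nneg {pf} => x es wp sX tX f0 nneg.
have [e ep eX] := walk_leaves wp sX tX.
by rewrite (bigD1 e) //= ep lerDl; apply: sumr_ge0 => e' _; apply: nneg.
Qed.

(** Every path of value 1 crosses one of the cuts [X r], so its flow is paid for by that cut. *)
Lemma multiflow_value_le (H : rel (node G)) (T : {set node G})
    (X : node G -> {set node G}) (f : multiflow R G) :
    (forall s t, H s t -> exists2 r, r \in T & (s \in X r) && (t \notin X r)) ->
  multiflow_value (mu_of H R) f <= (\sum_(r in T) cut_capacity (X r))%N%:R.
Proof.
move=> HX; rewrite natr_sum.
apply: (@le_trans _ _ (\sum_(r in T) \sum_(p <- paths f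
    | (path_start p \in X r) && (path_end p \notin X r)) flow f p));
  last by apply: ler_sum => r _; apply: flow_cut_le.
under [leRHS]eq_bigr do rewrite big_mkcond.
rewrite exchange_big /= /multiflow_value big_seq [leRHS]big_seq.
apply: ler_sum => p pf; have f0 := flow_ge0 pf.
have nneg r : 0 <= (if (path_start p \in X r) && (path_end p \notin X r)
    then flow f p else 0) by case: ifP.
rewrite /mu_of; have [/HX[r rT rX]|_] := boolP (H _ _).
  by rewrite mulr1 (bigD1 r) //= rX lerDl; apply: sumr_ge0.
by rewrite mulr0; apply: sumr_ge0.
Qed.

Lemma sum_count_fset (T : choiceType) (L : seq T) (P : pred T) :
  \sum_(p <- [fset p in L]%fset | P p) ((count_mem p L)%:R : R) = (count P L)%:R.
Proof.
transitivity (\sum_(p <- undup L | P p) ((count_mem p L)%:R : R)).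
  apply: perm_big; apply: uniq_perm; rewrite ?fset_uniq ?undup_uniq // => p.
  by rewrite mem_undup !inE.
transitivity (\sum_(p <- L | P p) (1 : R)); last by rewrite -sum1_count natr_sum.
by rewrite -[RHS]big_undup_iterop_count.
Qed.

Lemma multiflow_of_paths (H : rel (node G)) (L : seq (dpath G)) :
    all (@is_terminal_path G) L -> {in L, forall p, H (path_start p) (path_end p)} ->
    (forall e, usage L e <= capacity e)%N ->
  exists2 f : multiflow R G, integral_multiflow f &
    multiflow_value (mu_of H R) f = (size L)%:R.
Proof.
move=> termL HL useL.
(* A path repeated in [L] carries its multiplicity as flow. *)
pose P := [fset p in L]%fset; pose fl (p : dpath G) := (count_mem p L)%:R : R.
have PL p : p \in P -> p \in L by rewrite inE.
have t p : p \in P -> is_terminal_path p by move/PL; apply: (allP termL).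
have n p : p \in P -> 0 <= fl p by rewrite ler0n.
have c e : \sum_(p <- P | e \in p.2) fl p <= (capacity e)%:R.
  rewrite sum_count_fset ler_nat; apply: leq_trans (useL e).
  rewrite count_sum_bool; apply: leq_sum => p _.
  by rewrite -has_pred1 has_count; case: (count _ _).
exists (Multiflow t n c); first by move=> p _ /=; rewrite natr_int.
rewrite /multiflow_value /= big_seq.
under eq_bigr => p pP do rewrite /mu_of HL ?PL // mulr1.
by rewrite -big_seq sum_count_fset count_predT.
Qed.

End Multiflows.

(** * Quasi-complete digraphs: Eulerian nodes and walks for both types *)

Section QuasiComplete.
Local Open Scope nat_scope.
Variable G : network.

Variables (H : rel (node G)) (T : {set node G}).
Hypothesis H_qc : quasi_complete (terminals G) H T.
Hypothesis G_inner : inner_eulerian G.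
Hypothesis G_terminal : forall s : node G, s \in terminals G ->
  (degree H s + 2 <= #|T|)%N -> eulerian_at s.

Lemma nbh_self s : s \notin nbh H s.
Proof.
rewrite inE orbb; apply/negP => /(qc_simple H_qc)[_ _].
by rewrite eqxx.
Qed.

Lemma nbh_complete : {in T &, forall s t, s != t -> s \in nbh H t}.
Proof. by move=> s t sT tT st; rewrite inE orbC (qc_complete H_qc). Qed.

(** Such a [v] is an inner node or a terminal outside [T]; in the latter case its edges in [H] all
    have the same direction and join it to [T] without [s] and [t], so there are at most [#|T| - 2]
    of them. *)
Lemma eulerian_off_nbh v s t : s \in T -> t \in T -> s != t ->
  v \notin nbh H s -> v \notin nbh H t -> eulerian_at v.
Proof.
move=> sT tT st vs vt.
have [vS|/G_inner //] := boolP (v \in terminals G).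
apply: G_terminal => //.
have vT : v \notin T.
  apply/negP => vT; have [vs'|vs'] := eqVneq v s.
    by move: vt; rewrite vs' nbh_complete.
  by rewrite nbh_complete in vs.
have <- : #|T :\: [set s; t]| + 2 = #|T|.
  have sub : [set s; t] \subset T by rewrite subUset !sub1set sT.
  rewrite -(cardsID [set s; t] T) addnC; congr (_ + _).
  by rewrite (setIidPr sub) cards2 st.
rewrite leq_add2r /degree.
have off r : H r v || H v r -> r \notin [set s; t].
  move=> rv; rewrite !inE; apply/norP; split; apply/negP => /eqP rE; subst r.
    by rewrite inE rv in vs.
  by rewrite inE rv in vt.
have [leave|enter] := qc_crossing H_qc.
- have dir r : ~~ H v r.
    apply/negP => vr; move/forallP/(_ v)/forallP/(_ r)/implyP: leave.
    have := qc_incident H_qc vr; rewrite (negPf vT) /= => rT.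
    by rewrite vr rT => /(_ isT).
  (* All edges of [H] at [v] enter it, so each is determined by its tail. *)
  rewrite -(card_in_imset (f := fst)) => [|[a b] [a' b']]; last first.
    rewrite !inE /= => /andP[h1 /orP[/eqP h2|/eqP h2]];
      first by rewrite h2 (negPf (dir _)) in h1.
    move=> /andP[h3 /orP[/eqP h4|/eqP h4]];
      first by rewrite h4 (negPf (dir _)) in h3.
    by move=> ->; rewrite h2 h4.
  apply: subset_leq_card; apply/subsetP => r /imsetP[[a b]].
  rewrite inE /= => /andP[h1 /orP[/eqP h2|/eqP h2]] ->;
    first by rewrite h2 (negPf (dir _)) in h1.
  rewrite h2 in h1; rewrite inE off ?h1 //.
  by have := qc_incident H_qc h1; rewrite (negPf vT) orbF.
- have dir r : ~~ H r v.
    apply/negP => vr; move/forallP/(_ r)/forallP/(_ v)/implyP: enter.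
    have := qc_incident H_qc vr; rewrite (negPf vT) orbF => rT.
    by rewrite vr rT => /(_ isT).
  rewrite -(card_in_imset (f := snd)) => [|[a b] [a' b']]; last first.
    rewrite !inE /= => /andP[h1 /orP[/eqP h2|/eqP h2]]; last first.
      by rewrite h2 (negPf (dir _)) in h1.
    move=> /andP[h3 /orP[/eqP h4|/eqP h4]]; last first.
      by rewrite h4 (negPf (dir _)) in h3.
    by move=> ->; rewrite h2 h4.
  apply: subset_leq_card; apply/subsetP => r /imsetP[[a b]].
  rewrite inE /= => /andP[h1 /orP[/eqP h2|/eqP h2]] ->; last first.
    by rewrite h2 (negPf (dir _)) in h1.
  rewrite h2 in h1; rewrite inE off ?h1 ?orbT //.
  by have := qc_incident H_qc h1; rewrite (negPf vT).
Qed.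

Lemma sink_cutP s : exists2 X : {set node G},
    (s \in X) && (X \subset ~: nbh H s) & sink_cut H s = cut_capacity X /\
  forall Y : {set node G}, s \in Y -> Y \subset ~: nbh H s ->
    sink_cut H s <= cut_capacity Y.
Proof.
rewrite /sink_cut; case: arg_minnP => [|X fX minX].
  by rewrite set11 sub1set inE nbh_self.
by exists X => //; split => // Y sY YN; apply: minX; rewrite sY.
Qed.

Lemma source_cutP s : exists2 X : {set node G},
    (nbh H s \subset X) && (X \subset ~: [set s]) & source_cut H s = cut_capacity X /\
  forall Y : {set node G}, nbh H s \subset Y -> Y \subset ~: [set s] ->
    source_cut H s <= cut_capacity Y.
Proof.
rewrite /source_cut; case: arg_minnP => [|X fX minX].
  by rewrite subxx /= subsetC sub1set inE nbh_self.
by exists X => //; split => // Y NY Ys; apply: minX; rewrite NY.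
Qed.

Lemma paths_sink : crossing_leave H T -> exists L : seq (dpath G),
  [/\ all (@is_walk G) L, forall e, usage L e <= capacity e,
    {in L, forall p, H (path_start p) (path_end p)}
    & size L = \sum_(s in T) sink_cut H s].
Proof.
move=> leave.
have [||||L [wL uL tL szL]] := @terminal_walks G T (nbh H) _ _ (sink_cut H).
- by move=> s _; apply: nbh_self.
- exact: nbh_complete.
- exact: eulerian_off_nbh.
- move=> s X sT /andP[sX]; rewrite disjoints_subset => XN.
  by have [_ _ [_]] := sink_cutP s; apply.
(* A neighbour may be joined by the opposite edge only. Completeness settles this inside [T];
   outside, that edge would enter [T]. *)
exists L; split => // p /tL /andP[sT]; rewrite inE => /orP[//|ts].
have [tT|tT] := boolP (path_end p \in T).
  by apply: (qc_complete H_qc) => //; have [_ _] := qc_simple H_qc ts; rewrite eq_sym.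
by move/forallP/(_ (path_end p))/forallP/(_ (path_start p))/implyP: leave;
   rewrite ts sT (negPf tT) => /(_ isT).
Qed.

(** In the reversed network, complements of feasible sets of [s] are the sets containing [nbh H s]
    but not [s]. [H] itself stays, since [nbh] ignores directions. *)
Lemma paths_source : crossing_enter H T -> exists L : seq (dpath G),
  [/\ all (@is_walk G) L, forall e, usage L e <= capacity e,
    {in L, forall p, H (path_start p) (path_end p)}
    & size L = \sum_(s in T) source_cut H s].
Proof.
move=> enter.
have [||||L [wL uL tL szL]] :=
  @terminal_walks (rev_network G) T (nbh H) _ _ (source_cut H).
- by move=> s _; apply: nbh_self.
- exact: nbh_complete.
- by move=> v s t sT tT st vs vt; apply: eulerian_at_rev; apply: eulerian_off_nbh vs vt.
- move=> s X sT /andP[sX]; rewrite disjoints_subset => XN.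
  rewrite cut_capacity_rev; have [_ _ [_]] := source_cutP s; apply.
    by rewrite subsetC.
  by rewrite setCS sub1set.
exists (map (@rev_path G) L); split.
- by apply/allP => _ /mapP[p pL ->]; apply: (rev_pathP (allP wL p pL)).1.
- by move=> e; rewrite usage_rev_path.
- move=> _ /mapP[p pL ->]; rewrite (rev_pathP (allP wL p pL)).2.
  have /andP[sT] := tL p pL; rewrite inE /path_start /= => /orP[st|//].
  have [tT|tT] := boolP (path_end p \in T).
    by apply: (qc_complete H_qc) => //; have [_ _] := qc_simple H_qc st; rewrite eq_sym.
  by move/forallP/(_ (path_start p))/forallP/(_ (path_end p))/implyP: enter;
     rewrite st sT (negPf tT) => /(_ isT).
- by rewrite size_map.
Qed.

End QuasiComplete.

(** * The min-max equality *)

Local Open Scope ring_scope.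

(** The cut bound holds for every multiflow and is attained by an integral one, so both maxima equal
    it. *)
Lemma MFP_of_walks (R : realType) (G : network) (H : rel (node G)) (T : {set node G})
    (X : node G -> {set node G}) (L : seq (dpath G)) :
    simple_digraph (terminals G) H ->
    (forall s t, H s t -> exists2 r, r \in T & (s \in X r) && (t \notin X r)) ->
    all (@is_walk G) L -> (forall e, usage L e <= capacity e)%N ->
    {in L, forall p, H (path_start p) (path_end p)} ->
    size L = (\sum_(r in T) cut_capacity (X r))%N ->
  is_MFP (mu_of H R) (size L)%:R /\ is_IMFP (mu_of H R) (size L)%:R.
Proof.
move=> H_simple HX wL uL HL szL.
have [L' [dL' uL' eL']] := shorten_walks wL.
have HL' : {in L', forall p, H (path_start p) (path_end p)}.
  move=> p /(map_f (fun p => (path_start p, path_end p))); rewrite eL'.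
  by case/mapP => q qL [-> ->]; apply: HL.
have tL' : all (@is_terminal_path G) L'.
  apply/allP => p pL'; have [sS tS st] := H_simple _ _ (HL' p pL').
  by rewrite /is_terminal_path (allP dL' p pL') sS tS.
have sz : size L' = size L by have := congr1 size eL'; rewrite !size_map.
have [f fint fval] := multiflow_of_paths R tL' HL' (fun e => leq_trans (uL' e) (uL e)).
rewrite sz in fval.
have ub g : multiflow_value (mu_of H R) g <= (size L)%:R.
  by rewrite szL; apply: multiflow_value_le.
by split; split=> //; exists f.
Qed.

Theorem theorem3p8 (R : realType) (G : network)
    (H : rel (node G)) (T : {set node G})
    (H_qc : quasi_complete (terminals G) H T)
    (G_inner : inner_eulerian G)
    (G_terminal : forall s : node G, s \in terminals G ->
       (degree H s + 2 <= #|T|)%N -> eulerian_at s) :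
  exists v : R,
    [/\ is_MFP (mu_of H R) v,
        is_IMFP (mu_of H R) v,
        sink_type H T -> v = (\sum_(s in T) sink_cut H s)%N%:R
      & source_type H T -> v = (\sum_(s in T) source_cut H s)%N%:R].
Proof.
have H_simple := qc_simple H_qc.
rewrite /sink_type /source_type; have [enter|nenter] := boolP (crossing_enter H T).
  have [L [wL uL HL szL]] := paths_source H_qc G_inner G_terminal enter.
  exists (size L)%:R.
  have [] := @MFP_of_walks R G H T (fun s => [arg min_(X < nbh H s
      | (nbh H s \subset X) && (X \subset ~: [set s])) cut_capacity X]%N) L
      H_simple _ wL uL HL szL.
    (* Here every edge of [H] ends in [T], and the cut of its head separates its ends. *)
    move=> s t st; exists t.
      have := qc_incident H_qc st; have [//|tT] := boolP (t \in T).
      rewrite orbF => sT; move/forallP/(_ s)/forallP/(_ t)/implyP: enter.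
      by rewrite st sT (negPf tT) => /(_ isT).
    case: arg_minnP => [|X /andP[NX Xs] _].
      by rewrite subxx /= subsetC sub1set inE (nbh_self H_qc).
    rewrite (subsetP NX) ?inE ?st ?orbT //=.
    by rewrite subsetC sub1set inE in Xs.
  by split; rewrite // szL.
have leave : crossing_leave H T by case: (qc_crossing H_qc) nenter => [//|->].
have [L [wL uL HL szL]] := paths_sink H_qc G_inner G_terminal leave.
exists (size L)%:R.
have [] := @MFP_of_walks R G H T (fun s => [arg min_(X < [set s]
    | (s \in X) && (X \subset ~: nbh H s)) cut_capacity X]%N) L
    H_simple _ wL uL HL szL.
  (* Here every edge of [H] starts in [T], so the cut of its tail serves. *)
  move=> s t st; exists s.
    have := qc_incident H_qc st; have [//|sT] := boolP (s \in T).
    move=> /= tT; move/forallP/(_ s)/forallP/(_ t)/implyP: leave.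
    by rewrite st tT (negPf sT) => /(_ isT).
  case: arg_minnP => [|X /andP[sX XN] _].
    by rewrite set11 sub1set inE (nbh_self H_qc).
  rewrite sX; apply: contraTN isT => tX.
  by have := subsetP XN _ tX; rewrite !inE st.
by split; rewrite // szL.
Qed.
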